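(* Let $A$ be a $C^*$-algebra that is generated by its commutators as a not necessarily closed ideal. Then $[[A,A],[A,A]] = [A,A]$.
   Context: $C^*$-algebras are not assumed to be unital. For subsets $X, Y$ of a $C^*$-algebra, $[X,Y]$ denotes the linear span (no closure) of the set of commutators $[x,y] := xy - yx$ with $x \in X$, $y \in Y$. Ideals are two-sided and not necessarily closed. That $A$ is generated by its commutators as a not necessarily closed ideal means that the smallest (not necessarily closed) ideal of $A$ containing $[A,A]$ is $A$ itself. *)

(* Defs.v *)
From HB Require Import structures.
From mathcomp Require Import all_boot all_order all_algebra.
From mathcomp Require Import complex.
From mathcomp Require Import all_classical all_reals all_analysis.

Set Implicit Arguments.
Unset Strict Implicit.
Unset Printing Implicit Defensive.

Import Order.TTheory GRing.Theory Num.Theory.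
Import numFieldNormedType.Exports.

Local Open Scope classical_set_scope.
Local Open Scope ring_scope.

Reserved Notation "x *c y" (at level 40, left associativity).

(* MathComp rings have a unit, so the product of a possibly non-unital
   C*-algebra is an operation on a complex Banach space.  Norms take their
   values in the nonnegative reals inside R[i]. *)
HB.mixin Record CompleteNormedModule_isCStarAlgebra (R : realType) A
    & CompleteNormedModule R[i] A := {
  cstar_mul : A -> A -> A;
  cstar_adj : A -> A;
  cstar_mulA : associative cstar_mul;
  cstar_mulDl : left_distributive cstar_mul +%R;
  cstar_mulDr : right_distributive cstar_mul +%R;
  cstar_mulZl : forall (k : R[i]) (x y : A),
    cstar_mul (k *: x) y = k *: cstar_mul x y;
  cstar_mulZr : forall (k : R[i]) (x y : A),
    cstar_mul x (k *: y) = k *: cstar_mul x y;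
  cstar_adjK : involutive cstar_adj;
  cstar_adjD : {morph cstar_adj : x y / x + y};
  cstar_adjZ : forall (k : R[i]) (x : A),
    cstar_adj (k *: x) = k^* *: cstar_adj x;
  cstar_adjM : forall x y : A,
    cstar_adj (cstar_mul x y) = cstar_mul (cstar_adj y) (cstar_adj x);
  cstar_normM : forall x y : A, `|cstar_mul x y| <= `|x| * `|y|;
  cstar_normE : forall x : A, `|cstar_mul (cstar_adj x) x| = `|x| ^+ 2
}.

#[short(type="cstarAlgType")]
HB.structure Definition CStarAlgebra (R : realType) :=
  {A of CompleteNormedModule_isCStarAlgebra R A & CompleteNormedModule R[i] A}.

Notation "x *c y" := (cstar_mul x y) : ring_scope.

Definition commutator (R : realType) (A : cstarAlgType R) (x y : A) : A :=
  x *c y - y *c x.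

Definition linear_span (K : numFieldType) (V : lmodType K) (S : set V) :
    set V :=
  [set v | exists (n : nat) (k : 'I_n -> K) (s : 'I_n -> V),
    (forall i, S (s i)) /\ v = \sum_(i < n) k i *: s i].

Definition commutator_span (R : realType) (A : cstarAlgType R)
    (X Y : set A) : set A :=
  linear_span [set commutator x y | x in X & y in Y].

Definition is_ideal (R : realType) (A : cstarAlgType R) (I : set A) : Prop :=
  [/\ I 0,
      forall (k : R[i]) (x y : A), I x -> I y -> I (k *: x + y),
      forall a x : A, I x -> I (a *c x)
    & forall a x : A, I x -> I (x *c a)].

Definition ideal_generated (R : realType) (A : cstarAlgType R) (S : set A) :
    set A :=
  smallest (@is_ideal R A) S.

(* Main.v *)
(** Modulo a semiprime ideal containing [[K,K]], where [K = [[A,A],[A,A]]],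
    Herstein's argument makes first [K], then [[A,A]], then [A] central; so such
    an ideal contains all commutators and is [A].  Every proper ideal [J] of a
    C*-algebra lies in a proper semiprime ideal: a self-adjoint [h] outside [J]
    has one [b] dividing it to all powers, [h = b^n c_n], hence no power of [b]
    is in [J], and one can extend [J] keeping it clear of the powers of [b].
    Therefore [[K,K]] generates [A] as an ideal.  As the elements whose
    commutators with [A] lie in [K] contain the ideal generated by [[K,K]],
    it follows that [[A,A]] is contained in [K].

    The element [b] is obtained as in the Allan-Sinclair factorization theorem.
    With [e_t = h (h + i t)^-1], which behaves like an approximate unit for [h] as
    [t] tends to [0], let [F_N] be the product over [k < N] of the [(1 + e_{t_k}) / 2].
    If [t_k] decreases fast enough, [F_N] converges to an element [b] of [A] although
    the norms of [F_N^-1] grow exponentially, and [F_N^-n h] converges for every [n]. *)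
Require Import Defs.
From HB Require Import structures.
From mathcomp Require Import all_boot all_order all_algebra.
From mathcomp Require Import complex ring lra zify.
From mathcomp Require Import all_classical all_reals all_analysis.

Set Implicit Arguments.
Unset Strict Implicit.
Unset Printing Implicit Defensive.

Import Order.TTheory GRing.Theory Num.Theory.
Import numFieldNormedType.Exports.

Local Open Scope classical_set_scope.
Local Open Scope ring_scope.

(* Identities between linear combinations in a module over a commutative ring:
   [lmod] compares the coefficients of each atom with [ring] or [field]. *)
Inductive lexp (K : Type) : Type :=
| LVar of nat | LZero | LAdd of lexp K & lexp K | LOpp of lexp K
| LScale of K & lexp K.
Arguments LVar {K}.
Arguments LZero {K}.

Fixpoint leval (K : pzRingType) (V : lmodType K) (env : seq V) (e : lexp K) : V :=
  match e with
  | LVar i => env`_i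
  | LZero => 0
  | LAdd a b => leval env a + leval env b
  | LOpp a => - leval env a
  | LScale k a => k *: leval env a
  end.

(** The index test is [Nat.eqb] so that [simpl] evaluates it on numerals and [lmod] is left with
    scalar identities only. *)
Fixpoint lcoef (K : pzRingType) (e : lexp K) (i : nat) : K :=
  match e with
  | LVar j => if Nat.eqb i j then 1 else 0
  | LZero => 0
  | LAdd a b => lcoef a i + lcoef b i
  | LOpp a => - lcoef a i
  | LScale k a => k * lcoef a i
  end.

Fixpoint lcheck (K : pzRingType) (n : nat) (e f : lexp K) : Prop :=
  if n is m.+1 then lcoef e m = lcoef f m /\ lcheck m e f else True.

Lemma leval_coef (K : pzRingType) (V : lmodType K) (env : seq V) (e : lexp K) :
  leval env e = \sum_(i < size env) lcoef e i *: env`_i.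
Proof.
elim: e => /= [j||a -> b ->|a ->|k a ->].
- have eqbE (i : nat) : Nat.eqb i j = (i == j) by apply/idP/eqP => /PeanoNat.Nat.eqb_eq.
  case: (ltnP j (size env)) => [ltj|lej].
    rewrite (bigD1 (Ordinal ltj)) //= PeanoNat.Nat.eqb_refl scale1r big1 ?addr0 // => i.
    by rewrite -val_eqE /= -eqbE => /negbTE ->; rewrite scale0r.
  rewrite nth_default // big1 // => i _.
  case E : (Nat.eqb i j); last by rewrite scale0r.
  move/PeanoNat.Nat.eqb_eq: E => E; move: (ltn_ord i); by rewrite E ltnNge lej.
- by rewrite big1 // => i _; rewrite scale0r.
- by rewrite -big_split /=; apply: eq_bigr => i _; rewrite scalerDl.
- by rewrite -sumrN; apply: eq_bigr => i _; rewrite scaleNr.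
- by rewrite scaler_sumr; apply: eq_bigr => i _; rewrite scalerA.
Qed.

Lemma leval_check (K : pzRingType) (V : lmodType K) (env : seq V) (e f : lexp K) :
  lcheck (size env) e f -> leval env e = leval env f.
Proof.
move=> h; rewrite !leval_coef; apply: eq_bigr => i _.
suff -> : lcoef e i = lcoef f i by [].
elim: (size env) h (i : nat) (ltn_ord i) => [|n IHn] //= [hn h] j.
by rewrite ltnS leq_eqVlt => /orP[/eqP ->//|]; apply: IHn.
Qed.

Ltac lfind x l :=
  match l with
  | x :: _ => constr:(Some 0%N)
  | _ :: ?l' => match lfind x l' with
                | Some ?n => constr:(Some (S n))
                | None => constr:(@None nat)
                end
  | _ => constr:(@None nat)
  end.
Ltac lsnoc x l :=
  match l with
  | ?y :: ?l' => let r := lsnoc x l' in constr:(y :: r)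
  | _ => constr:(x :: l)
  end.
Ltac llen l := match l with _ :: ?l' => let n := llen l' in constr:(S n) | _ => constr:(0%N) end.
Ltac lreify K l t :=
  match t with
  | (?a + ?b)%R => match lreify K l a with (?ea, ?l1) =>
      match lreify K l1 b with (?eb, ?l2) => constr:((@LAdd K ea eb, l2)) end end
  | (- ?a)%R => match lreify K l a with (?ea, ?l1) => constr:((@LOpp K ea, l1)) end
  | (?k *: ?a)%R => match lreify K l a with (?ea, ?l1) => constr:((@LScale K k ea, l1)) end
  | 0%R => constr:((@LZero K, l))
  | _ => match lfind t l with
         | Some ?n => constr:((@LVar K n, l))
         | None => let n := llen l in let l' := lsnoc t l in constr:((@LVar K n, l'))
         end
  end.

Ltac lmod :=
  match goal with
  | |- @eq ?V ?x ?y =>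
    match type of (fun k (u : V) => (k *: x)%R) with
    | ?K -> _ -> _ =>
      match lreify K (@nil V) x with (?ex, ?l1) =>
        match lreify K l1 y with (?ey, ?l2) =>
          apply: (@leval_check _ _ l2 ex ey); simpl; repeat split;
          first [done | ring | by field]
        end end end end.

(** * Bilinearity of the product *)

Lemma cmul0l (R : realType) (A : cstarAlgType R) (x : A) : 0 *c x = 0.
Proof. by have := cstar_mulZl 0 0 x; rewrite !scale0r. Qed.

Lemma cmul0r (R : realType) (A : cstarAlgType R) (x : A) : x *c 0 = 0.
Proof. by have := cstar_mulZr 0 x 0; rewrite !scale0r. Qed.

Lemma cmulNl (R : realType) (A : cstarAlgType R) (x y : A) : - x *c y = - (x *c y).
Proof. by rewrite -scaleN1r cstar_mulZl scaleN1r. Qed.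

Lemma cmulNr (R : realType) (A : cstarAlgType R) (x y : A) : x *c - y = - (x *c y).
Proof. by rewrite -[- y]scaleN1r cstar_mulZr scaleN1r. Qed.

Definition cmulE (R : realType) (A : cstarAlgType R) :=
  (@cstar_mulDl R A, @cstar_mulDr R A, @cstar_mulZl R A, @cstar_mulZr R A,
   @cmulNl R A, @cmulNr R A, @cmul0l R A, @cmul0r R A, @cstar_mulA R A).

Ltac alg := rewrite /commutator ?cmulE; lmod.

(** * Norm estimates *)

(** A norm in [R[i]] is a nonnegative real, so its real part loses nothing and puts the estimates in
    an ordered field. *)
Definition rnorm (R : realType) (A : cstarAlgType R) (x : A) : R := complex.Re `|x|.
Arguments rnorm {R A}.

Section Norm.
Variables (R : realType) (A : cstarAlgType R).
Implicit Types (x y : A) (t : R).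
Local Open Scope complex_scope.

Lemma rnormE x : `|x| = (rnorm x)%:C.
Proof. by rewrite /rnorm; case: `|x| (normr_ge0 x) => a b; rewrite lecE /= => /andP[/eqP ->]. Qed.

Lemma rnorm_ge0 x : 0 <= rnorm x.
Proof. by rewrite -lecR -rnormE normr_ge0. Qed.

Lemma rnorm_eq0 x : rnorm x <= 0 -> x = 0.
Proof.
move=> h; apply/normr0_eq0; rewrite rnormE.
by have -> : rnorm x = 0 by apply/le_anti; rewrite h rnorm_ge0.
Qed.

Lemma rnormD x y : rnorm (x + y) <= rnorm x + rnorm y.
Proof. by rewrite -lecR raddfD /= -!rnormE ler_normD. Qed.

Lemma rnormN x : rnorm (- x) = rnorm x.
Proof. by rewrite /rnorm normrN. Qed.

Lemma rnorm_distC x y : rnorm (x - y) = rnorm (y - x).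
Proof. by rewrite -opprB rnormN. Qed.

Lemma rnorm0 : rnorm (0 : A) = 0.
Proof. by rewrite /rnorm normr0. Qed.

Lemma rnormB x y : rnorm (x - y) <= rnorm x + rnorm y.
Proof. by rewrite -(rnormN y) rnormD. Qed.

Lemma rnormM x y : rnorm (x *c y) <= rnorm x * rnorm y.
Proof. by rewrite -lecR rmorphM /= -!rnormE cstar_normM. Qed.

Lemma rnorm_adj_mul x : rnorm (cstar_adj x *c x) = rnorm x ^+ 2.
Proof. by apply: complexI; rewrite rmorphXn /= -!rnormE cstar_normE. Qed.

Lemma rnorm_adj x : rnorm (cstar_adj x) = rnorm x.
Proof.
have le (y : A) : rnorm y <= rnorm (cstar_adj y).
  have := rnormM (cstar_adj y) y; rewrite rnorm_adj_mul.
  have := rnorm_ge0 y; rewrite le_eqVlt => /orP[/eqP <- _|y0]; first exact: rnorm_ge0.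
  by rewrite expr2 ler_pM2r.
by apply/le_anti; rewrite le -{2}(cstar_adjK x) le.
Qed.

Lemma rnormZ (k : R[i]) x : rnorm (k *: x) = Normc.normc k * rnorm x.
Proof. by apply: complexI; rewrite rmorphM /= -!rnormE normrZ. Qed.

Lemma rnormZr t x : 0 <= t -> rnorm (t%:C *: x) = t * rnorm x.
Proof. by move=> t0; rewrite rnormZ /= expr0n addr0 sqrtr_sqr ger0_norm. Qed.

Lemma rnorm_half x : rnorm (2^-1 *: x) = 2^-1 * rnorm x.
Proof.
have -> : (2^-1 : R[i]) = (2^-1)%:C by rewrite fmorphV rmorph_nat.
by rewrite rnormZr // invr_ge0 ler0n.
Qed.

Lemma rnorm_eq_lim0 (C : R) x : (forall n, rnorm x <= C / 2 ^+ n) -> x = 0.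
Proof.
move=> h; apply: rnorm_eq0; apply/ler_addgt0Pl => e e0; rewrite addr0.
have C0 : 0 <= C by have := h 0%N; rewrite expr0 divr1; apply: le_trans (rnorm_ge0 _).
have [n hn] : exists n, C <= e * 2 ^+ n.
  exists (Num.truncn (C / e)).+1; rewrite mulrC -ler_pdivrMr //.
  have /andP[_ /ltW /le_trans] := truncn_itv (divr_ge0 C0 (ltW e0)); apply.
  by rewrite -natrX ler_nat ltnW // ltn_expl.
by apply: le_trans (h n) _; rewrite ler_pdivrMr // exprn_gt0.
Qed.

Lemma geometric_increments_converge (C : R) (x : nat -> A) :
  (forall n, rnorm (x n.+1 - x n) <= C / 2 ^+ n) ->
  exists l, forall n, rnorm (l - x n) <= 2 * C / 2 ^+ n.
Proof.
move=> hx.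
have C0 : 0 <= C by have := hx 0%N; rewrite expr0 divr1; apply: le_trans (rnorm_ge0 _).
have pow0 n : 0 < 2 ^+ n :> R by rewrite exprn_gt0.
(* The subtracted tail makes the induction close with equality. *)
have hd n k : rnorm (x (n + k)%N - x n) <= 2 * C / 2 ^+ n - 2 * C / 2 ^+ (n + k).
  elim: k => [|k IHk]; first by rewrite addn0 !subrr rnorm0.
  have -> : x (n + k.+1)%N - x n = (x (n + k)%N.+1 - x (n + k)%N) + (x (n + k)%N - x n).
    by rewrite addrA subrK addnS.
  apply: le_trans (rnormD _ _) _; apply: le_trans (lerD (hx _) IHk) _.
  by rewrite addnS exprS le_eqVlt; apply/orP; left; apply/eqP; field; rewrite !gt_eqF.
have hle n m : (n <= m)%N -> rnorm (x m - x n) <= 2 * C / 2 ^+ n.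
  move=> /subnKC <-; apply: le_trans (hd _ _) _.
  by rewrite gerBl divr_ge0 ?mulr_ge0 // ltW.
have small e : 0 < e -> exists n, 2 * C / 2 ^+ n < e.
  move=> e0; exists (Num.truncn (2 * C / e)).+1; rewrite ltr_pdivrMr // [e * _]mulrC -ltr_pdivrMr //.
  have /andP[_ /lt_le_trans] := truncn_itv (divr_ge0 (mulr_ge0 (ler0n R 2) C0) (ltW e0)); apply.
  by rewrite -natrX ler_nat ltnW // ltn_expl.
have ReC (e : R[i]) : 0 < e -> e = (complex.Re e)%:C /\ 0 < complex.Re e.
  by case: e => a b; rewrite ltcE /= => /andP[/eqP ->].
have cx : cvg (x n @[n --> \oo]).
  apply/cauchy_cvgP/cauchy_exP => eps /ReC[-> /small[n hn]].
  exists (x n); exists n => // m /= nm.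
  rewrite -ball_normE /ball_ /= rnormE ltcR rnorm_distC; exact: le_lt_trans (hle _ _ nm) hn.
exists (lim (x n @[n --> \oo])) => n; apply/ler_addgt0Pr => e e0.
have /cvgrPdist_lt /(_ (e%:C)) : x n @[n --> \oo] --> lim (x n @[n --> \oo]) by [].
rewrite ltcR => /(_ e0) [N _ hN].
have := hN (maxn N n) (leq_maxl _ _); rewrite /= rnormE ltcR => h.
set l := lim _ in h *.
have -> : l - x n = (l - x (maxn N n)) + (x (maxn N n) - x n) by rewrite addrA subrK.
apply: le_trans (rnormD _ _) _; rewrite addrC; apply: lerD (ltW h).
exact: hle (leq_maxr _ _).
Qed.

(** The iterates are the partial sums of the Neumann series of (1 - q)^-1 y. The fixed-point form
    avoids a unit, which [A] may lack. *)
Lemma contraction_fixed (y : A) (q : A -> A) :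
  (forall u v, q (u - v) = q u - q v) ->
  (forall u, rnorm (q u) <= 2^-1 * rnorm u) -> exists e, e = y + q e.
Proof.
move=> qB qle; pose x := fun n => iter n (fun u => y + q u) 0.
have [|l hl] := @geometric_increments_converge (rnorm y) x.
  elim=> [|n IHn].
    rewrite expr0 divr1 /= subr0.
    have -> : q 0 = 0 by have := qB 0 0; rewrite !subrr.
    by rewrite addr0.
  have -> : x n.+2 - x n.+1 = q (x n.+1 - x n) by rewrite qB /= opprD addrACA subrr add0r.
  apply: le_trans (qle _) _; rewrite exprSr invfM mulrA [_ * 2^-1]mulrC.
  by rewrite ler_pM2l // invr_gt0.
exists l; apply/subr0_eq; apply: (@rnorm_eq_lim0 (2 * rnorm y)) => n.
have -> : l - (y + q l) = (l - x n.+1) - q (l - x n) by rewrite qB /=; lmod.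
apply: le_trans (rnormB _ _) _.
apply: le_trans (lerD (hl _) (le_trans (qle _) (ler_wpM2l _ (hl n)))) _; rewrite ?invr_ge0 //.
by rewrite exprSr le_eqVlt; apply/orP; left; apply/eqP; field; rewrite gt_eqF // exprn_gt0.
Qed.

End Norm.

(** * Resolvents of self-adjoint elements *)

Definition imag (R : realType) (t : R) : R[i] := (0 +i* t)%C.

Section SelfAdjoint.
Variables (R : realType) (A : cstarAlgType R) (h : A).
Hypothesis h_sa : cstar_adj h = h.
Implicit Types (x y z u : A) (s t : R).
Local Open Scope complex_scope.

Lemma conj_imag t : ((imag t)^* = - imag t)%R.
Proof. by apply/eqP; rewrite eq_complex /= oppr0 !eqxx. Qed.

Lemma rnorm_imag t x : 0 <= t -> rnorm (imag t *: x) = t * rnorm x.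
Proof. by move=> t0; rewrite rnormZ /= expr0n add0r sqrtr_sqr ger0_norm. Qed.

(** By the C*-identity both squared norms are the norm of y^* (h^2 + t^2) y, where the sign of t has
    disappeared. *)
Lemma rnorm_imag_sym t y : rnorm (h *c y + imag t *: y) = rnorm (h *c y - imag t *: y).
Proof.
apply/eqP; rewrite -(@eqrXn2 _ 2) ?rnorm_ge0 // -!rnorm_adj_mul -scaleNr !cstar_adjD.
rewrite !cstar_adjZ cstar_adjM h_sa rmorphN /= conj_imag.
by apply/eqP; congr rnorm; alg.
Qed.

(* [h + i t] and [h - i t] are equally long on [y], and they differ by [2 i t]. *)
Lemma imag_lower t y : 0 <= t -> t * rnorm y <= rnorm (h *c y + imag t *: y).
Proof.
move=> t0; have : rnorm (imag (2 * t) *: y) = 2 * t * rnorm y by rewrite rnorm_imag // mulr_ge0.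
have -> : imag (2 * t) *: y = (h *c y + imag t *: y) - (h *c y - imag t *: y).
  have -> : imag (2 * t) = imag t + imag t by apply/eqP; rewrite eq_complex /= addr0 mulr_natl mulr2n !eqxx.
  by lmod.
move=> E; have := rnormB (h *c y + imag t *: y) (h *c y - imag t *: y).
rewrite E -rnorm_imag_sym; lra.
Qed.

Lemma imag_inj t y : 0 < t -> h *c y + imag t *: y = 0 -> y = 0.
Proof.
move=> t0 E; apply: rnorm_eq0; have := @imag_lower t y (ltW t0).
by rewrite E rnorm0 pmulr_rle0.
Qed.

(** In a unitization this says e = h (h + i t)^-1, that is, 1 - e = i t (h + i t)^-1. *)
Definition resolvent t e := h *c e + imag t *: e = h.

Lemma resolvent_apply t e x : resolvent t e ->
  h *c (x - e *c x) + imag t *: (x - e *c x) = imag t *: x.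
Proof.
move=> he; have : (h *c e + imag t *: e) *c x = h *c x by rewrite he.
rewrite !cmulE => E; transitivity (imag t *: x + h *c x - (h *c e *c x + imag t *: (e *c x))); first by alg.
by rewrite E addrK.
Qed.

Lemma resolvent_contract t e x : 0 < t -> resolvent t e -> rnorm (x - e *c x) <= rnorm x.
Proof.
move=> t0 /resolvent_apply he; have := @imag_lower t (x - e *c x) (ltW t0).
by rewrite he rnorm_imag ?ler_pM2l // ltW.
Qed.

Lemma resolvent_comm t e w : 0 < t -> resolvent t e -> w *c h = h *c w -> w *c e = e *c w.
Proof.
move=> t0 he wh; apply/eqP; rewrite -subr_eq0; apply/eqP; apply: (@imag_inj t) => //.
transitivity (h *c w *c e + imag t *: (w *c e) - (h *c e + imag t *: e) *c w); first by alg.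
rewrite he -wh; have : w *c (h *c e + imag t *: e) = w *c h by rewrite he.
by rewrite !cmulE => ->; rewrite wh subrr.
Qed.

(** Since h + i t/2 = (h + i t)(1 - (1 - e)/2), the new element solves e' = e + (1 - e) e'/2, and 1
    - e is a contraction. *)
Lemma resolvent_halve t e : 0 < t -> resolvent t e -> exists e', resolvent (t / 2) e'.
Proof.
move=> t0 he.
have [|u|e' he'] := @contraction_fixed R A e (fun u => 2^-1 *: (u - e *c u)).
- by move=> u v; alg.
- rewrite rnorm_half ler_pM2l ?invr_gt0 //; exact: resolvent_contract he.
exists e'; rewrite /resolvent.
have -> : imag (t / 2) = 2^-1 * imag t.
  have -> : (2^-1 : R[i]) = (2^-1)%:C by rewrite fmorphV rmorph_nat.
  by apply/eqP; rewrite eq_complex /= !(mul0r, mulr0) subr0 addr0 mulrC !eqxx.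
have E : h *c e' + imag t *: e' = (h *c e + imag t *: e)
   + 2^-1 *: (h *c (e' - e *c e') + imag t *: (e' - e *c e')) by rewrite {1 2}he'; alg.
rewrite he resolvent_apply // in E.
transitivity (h *c e' + imag t *: e' - 2^-1 *: (imag t *: e')); first by lmod.
by rewrite E addrK.
Qed.

(** Here [c] is 1/(i t), and the equation for e is rewritten as e = c h - c h e, contracting because
    t is at least twice the norm of h. *)
Lemma resolvent_large t : 0 < t -> 2 * rnorm h <= t -> exists e, resolvent t e.
Proof.
move=> t0 ht; pose c := imag (- t^-1).
have cE : imag t * c = 1.
  by apply/eqP; rewrite eq_complex /=; apply/andP; split; apply/eqP; field; rewrite gt_eqF.
have nc x : rnorm (c *: x) = t^-1 * rnorm x.
  by rewrite rnormZ /= expr0n add0r sqrtr_sqr normrN ger0_norm // invr_ge0 ltW.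
have [|u|e he] := @contraction_fixed R A (c *: h) (fun u => - (c *: (h *c u))).
- by move=> u v; alg.
- rewrite rnormN nc; apply: le_trans (ler_wpM2l _ (rnormM _ _)) _; first by rewrite invr_ge0 ltW.
  rewrite mulrA ler_wpM2r ?rnorm_ge0 // mulrC ler_pdivrMr //; lra.
exists e; rewrite /resolvent {2}he.
transitivity (h *c e + (imag t * c) *: (h - h *c e)); first by lmod.
by rewrite cE scale1r addrC subrK.
Qed.

Lemma resolvent_exists t : 0 < t -> exists e, resolvent t e.
Proof.
move=> t0; have [n] : exists n, 2 * rnorm h <= t * 2 ^+ n.
  exists (Num.truncn (2 * rnorm h / t)).+1; rewrite [t * _]mulrC -ler_pdivrMr //.
  have /andP[_ /ltW /le_trans] := truncn_itv (divr_ge0 (mulr_ge0 (ler0n R 2) (rnorm_ge0 h)) (ltW t0)).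
  by apply; rewrite -natrX ler_nat ltnW // ltn_expl.
elim: n t t0 => [|n IHn] t t0 ht; first by apply: resolvent_large; rewrite // -[t]mulr1.
have [||e he] := IHn (t * 2); first by rewrite mulr_gt0.
  by rewrite -mulrA -exprS.
by have [|e' he'] := resolvent_halve _ he; [rewrite mulr_gt0|exists e'; rewrite mulfK in he'].
Qed.

End SelfAdjoint.

(** * Power factorization *)

Section Factorization.
Variables (R : realType) (A : cstarAlgType R) (h : A).
Hypothesis h_sa : cstar_adj h = h.
Variable e : R -> A.
Hypothesis eP : forall t, 0 < t -> resolvent h t (e t).
Implicit Types (x y z u w : A) (s t : R) (n N : nat).

(** The bicommutant of [h]: any two of its members commute, and it contains every [e t] with t >
    0. *)
Let bicomm z := forall w, w *c h = h *c w -> w *c z = z *c w.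

Lemma bicomm_e t : 0 < t -> bicomm (e t).
Proof. by move=> t0 w; apply: resolvent_comm (eP t0). Qed.

Lemma bicommC x y : bicomm x -> bicomm y -> x *c y = y *c x.
Proof. by move=> bx by_; apply: by_; rewrite -bx. Qed.

Lemma bicommM x y : bicomm x -> bicomm y -> bicomm (x *c y).
Proof. by move=> bx by_ w wh; rewrite cstar_mulA bx // -cstar_mulA by_ // cstar_mulA. Qed.

Lemma bicommD x y : bicomm x -> bicomm y -> bicomm (x + y).
Proof. by move=> bx by_ w wh; rewrite !cmulE bx // by_. Qed.

Lemma bicommZ (k : R[i]) x : bicomm x -> bicomm (k *: x).
Proof. by move=> bx w wh; rewrite !cmulE bx. Qed.

(** Left multiplication by [e t] has norm at most 2 because 1 - e_t is a contraction; evaluating at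
    the adjoint of [e t], the C*-identity turns this into a bound on the element. *)
Lemma rnorm_e t : 0 < t -> rnorm (e t) <= 2.
Proof.
move=> t0; have le x : rnorm (e t *c x) <= 2 * rnorm x.
  have := resolvent_contract h_sa x t0 (eP t0).
  have {2}-> : e t *c x = x - (x - e t *c x) by lmod.
  have := rnormB x (x - e t *c x); lra.
have := le (cstar_adj (e t)); rewrite -{1}(cstar_adjK (e t)) rnorm_adj_mul rnorm_adj expr2.
have := rnorm_ge0 (e t); rewrite le_eqVlt => /orP[/eqP <-|e0]; first by [].
by rewrite ler_pM2r.
Qed.

Lemma rnorm_e_h t : 0 < t -> rnorm (h - e t *c h) <= 2 * t.
Proof.
move=> t0; have -> : h - e t *c h = imag t *: e t.
  by rewrite -(bicomm_e t0) // -{1}(eP t0) addrC addKr.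
by rewrite rnorm_imag ?(ltW t0) // mulrC ler_pM2r // rnorm_e.
Qed.

(** Multiplying (1 - e_t) e_s by h + i s gives (1 - e_t) h, which is small by [rnorm_e_h];
    [imag_lower] costs the factor 1/s. *)
Lemma rnorm_e_e s t : 0 < s -> 0 < t -> rnorm (e s - e t *c e s) <= 2 * t / s.
Proof.
move=> s0 t0; rewrite ler_pdivlMr // mulrC.
apply: le_trans (imag_lower h_sa _ (ltW s0)) (le_trans _ (rnorm_e_h t0)).
rewrite le_eqVlt; apply/orP; left; apply/eqP; congr rnorm.
transitivity ((h *c e s + imag s *: e s) - (h *c e t *c e s + imag s *: (e t *c e s))); first by alg.
have -> : h *c e t = e t *c h by apply: bicomm_e.
transitivity ((h *c e s + imag s *: e s) - e t *c (h *c e s + imag s *: e s)); first by alg.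
by rewrite (eP s0).
Qed.

(** This is (1 + e_t)(2 - e_{t/2}) = 2 freed of the unit: the inverse of (1 + e_t)/2 is 2 -
    e_{t/2}. *)
Lemma e_halve t : 0 < t -> 2 *: e t - e (t / 2) - e t *c e (t / 2) = 0.
Proof.
move=> t0; have t20 : 0 < t / 2 by rewrite divr_gt0.
apply: (imag_inj h_sa t0).
set f := e (t / 2).
transitivity (2 *: (h *c e t + imag t *: e t) - h *c f - imag t *: f - (h *c e t + imag t *: e t) *c f); first by alg.
have E : h *c f + imag (t / 2) *: f = h by apply: eP.
have Ei : imag t = 2 * imag (t / 2).
  rewrite mulr_natl mulr2n; apply/eqP; rewrite eq_complex /=; apply/andP; by split; apply/eqP; field.
rewrite (eP t0) Ei -{1}E; lmod.
Qed.

(** The quadratic exponent outweighs, for every fixed n, the growth 2^(n N) of the n-th inverse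
    powers of the products. *)
Definition step_size N : R := (2 ^+ (N ^ 2))^-1.

Lemma step_size_gt0 N : 0 < step_size N.
Proof. by rewrite invr_gt0 exprn_gt0. Qed.

Lemma half_step_size_gt0 N : 0 < step_size N / 2.
Proof. by rewrite divr_gt0 ?step_size_gt0. Qed.

Lemma step_sizeS N : (step_size N)^-1 * 2 ^+ (N.*2.+1) = (step_size N.+1)^-1.
Proof. by rewrite !invrK -exprD; congr (_ ^+ _); rewrite -addnn; lia. Qed.

(* The product [F N] below acts as the scalar [2^-N] plus [cpart N]. *)
Fixpoint cpart N : A :=
  if N is M.+1 then
    2^-1 *: (cpart M + (2^-1) ^+ M *: e (step_size M) + cpart M *c e (step_size M))
  else 0.

Let F N x := (2^-1) ^+ N *: x + cpart N *c x.

Lemma bicomm_cpart N : bicomm (cpart N).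
Proof.
elim: N => [|N IHN] /=; first by move=> w _; rewrite !cmulE.
have be := bicomm_e (step_size_gt0 N).
by apply/bicommZ/bicommD; [apply: bicommD => //; apply: bicommZ|apply: bicommM].
Qed.

Lemma FS N x : F N.+1 x = F N (2^-1 *: (x + e (step_size N) *c x)).
Proof. by rewrite /F /= exprSr; alg. Qed.

Lemma rnorm_half_e t x : 0 < t -> rnorm (2^-1 *: (x + e t *c x)) <= 2 * rnorm x.
Proof.
move=> t0; rewrite rnorm_half.
have := resolvent_contract h_sa x t0 (eP t0); have := rnorm_ge0 x.
have -> : x + e t *c x = (x + x) - (x - e t *c x) by lmod.
have := rnormB (x + x) (x - e t *c x).
have := rnormD x x; lra.
Qed.

Lemma rnorm_F N x : rnorm (F N x) <= 2 ^+ N * rnorm x.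
Proof.
elim: N x => [|N IHN] x; first by rewrite /F expr0 scale1r /= cmul0l addr0 mul1r.
rewrite FS; apply: le_trans (IHN _) _; rewrite exprSr -mulrA ler_pM2l ?exprn_gt0 //.
exact: rnorm_half_e (step_size_gt0 N).
Qed.

Lemma rnorm_halfX N x : rnorm ((2^-1) ^+ N *: x) = rnorm x / 2 ^+ N.
Proof.
elim: N => [|N IHN]; first by rewrite scale1r divr1.
by rewrite exprS -scalerA rnorm_half IHN exprS invfM mulrCA.
Qed.

(** In the recursion (1 - e_t) acts on the old part and on F_N e_{t_N}, the latter costing 2^N
    2t/t_N. The drop from t_N to t_{N+1} absorbs both, and at t = t_N the bound becomes 2/2^N. *)
Lemma rnorm_cpart t N : 0 < t ->
  rnorm (cpart N - e t *c cpart N) <= 2 * t * ((step_size N)^-1 / 2 ^+ N).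
Proof.
move=> t0; elim: N => [|N IHN].
  by rewrite /= cmul0r subr0 rnorm0 !mulr_ge0 ?invr_ge0 ?ltW ?step_size_gt0.
have ce := bicommC (bicomm_cpart N) (bicomm_e t0).
have -> : cpart N.+1 - e t *c cpart N.+1 =
    2^-1 *: ((cpart N - e t *c cpart N) + F N (e (step_size N) - e t *c e (step_size N))).
  transitivity (2^-1 *: ((cpart N - e t *c cpart N) + (2^-1) ^+ N *: (e (step_size N) - e t *c e (step_size N))
     + cpart N *c e (step_size N) - e t *c cpart N *c e (step_size N))); first by rewrite /=; alg.
  by rewrite -ce /F; alg.
rewrite rnorm_half; set a := rnorm _; have {}Ea : a <= 2 * t * ((step_size N)^-1 / 2 ^+ N) + 2 ^+ N * (2 * t / step_size N).
  apply: le_trans (rnormD _ _) _; apply: lerD => //.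
  apply: le_trans (rnorm_F _ _) _; rewrite ler_pM2l ?exprn_gt0 //.
  exact: rnorm_e_e (step_size_gt0 N) t0.
rewrite -step_sizeS.
have -> : (step_size N)^-1 * 2 ^+ N.*2.+1 / 2 ^+ N.+1 = (step_size N)^-1 * 2 ^+ N :> R.
  rewrite -mulrA -addnn -addnS exprD mulrK // unitrX //; exact: unitf_gt0.
have h1 : (step_size N)^-1 / 2 ^+ N <= (step_size N)^-1 * 2 ^+ N :> R.
  have h2 : 1 <= 2 ^+ N :> R by rewrite exprn_ege1 // ler1n.
  by rewrite ler_pM2l ?invr_gt0 ?step_size_gt0 // (le_trans _ h2) // invf_le1 // exprn_gt0.
have := ler_wpM2l (ltW (mulr_gt0 (ltr0Sn R 1) t0)) h1; lra.
Qed.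

Lemma cpart_increment N : rnorm (cpart N.+1 - cpart N) <= 2 / 2 ^+ N.
Proof.
have s0 := step_size_gt0 N; have ce := bicommC (bicomm_cpart N) (bicomm_e s0).
have -> : cpart N.+1 - cpart N =
    2^-1 *: ((2^-1) ^+ N *: e (step_size N) - (cpart N - e (step_size N) *c cpart N)).
  by rewrite /= ce; lmod.
rewrite rnorm_half; have := rnormB ((2^-1) ^+ N *: e (step_size N)) (cpart N - e (step_size N) *c cpart N).
rewrite rnorm_halfX; have := rnorm_cpart N s0.
rewrite -mulrA mulVKf ?gt_eqF //.
have : rnorm (e (step_size N)) / 2 ^+ N <= 2 / 2 ^+ N by rewrite ler_pM2r ?invr_gt0 ?exprn_gt0 // rnorm_e.
lra.
Qed.

(* [g N] is the inverse of the factor [(1 + e_N) / 2] of [F N.+1]; see [F_g]. *)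
Let g N x := 2 *: x - e (step_size N / 2) *c x.

Lemma gB N x y : g N (x - y) = g N x - g N y.
Proof. by rewrite /g; alg. Qed.

Lemma g_comm N z x : bicomm z -> z *c g N x = g N (z *c x).
Proof.
move=> bz; rewrite /g; have ze := bicommC bz (bicomm_e (half_step_size_gt0 N)).
by rewrite !cmulE ze.
Qed.

Lemma g_sub N x : g N x - x = x - e (step_size N / 2) *c x.
Proof. by rewrite /g; lmod. Qed.

Lemma rnorm_g N x : rnorm (g N x) <= 2 * rnorm x.
Proof.
have := rnormD (g N x - x) x; rewrite subrK g_sub.
have := resolvent_contract h_sa x (half_step_size_gt0 N) (eP (half_step_size_gt0 N)); lra.
Qed.

Lemma rnorm_iter_g n N x : rnorm (iter n (g N) x) <= 2 ^+ n * rnorm x.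
Proof.
elim: n => [|n IHn]; first by rewrite mul1r.
by apply: le_trans (rnorm_g _ _) _; rewrite exprS -mulrA ler_pM2l.
Qed.

Lemma rnorm_iter_g_sub n N x :
  rnorm (iter n (g N) x - x) <= 2 ^+ n * rnorm (x - e (step_size N / 2) *c x).
Proof.
(* The sharper constant satisfies 2 (2^n - 1) + 1 = 2^(n+1) - 1, as the induction requires. *)
suff : rnorm (iter n (g N) x - x) <= (2 ^+ n - 1) * rnorm (x - e (step_size N / 2) *c x).
  have := rnorm_ge0 (x - e (step_size N / 2) *c x); lra.
elim: n => [|n IHn]; first by rewrite subrr rnorm0 subrr mul0r.
have -> : iter n.+1 (g N) x - x = g N (iter n (g N) x - x) + (x - e (step_size N / 2) *c x).
  by rewrite gB /= -g_sub; lmod.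
have := rnormD (g N (iter n (g N) x - x)) (x - e (step_size N / 2) *c x).
have := rnorm_g N (iter n (g N) x - x); rewrite exprS; lra.
Qed.

Lemma iter_gB n N x y : iter n (g N) (x - y) = iter n (g N) x - iter n (g N) y.
Proof. by elim: n => //= n ->; rewrite gB. Qed.

Lemma iter_g_comm n N z x : bicomm z -> z *c iter n (g N) x = iter n (g N) (z *c x).
Proof. by move=> bz; elim: n => //= n <-; rewrite g_comm. Qed.

Lemma iter_gZ n N (k : R[i]) x : iter n (g N) (k *: x) = k *: iter n (g N) x.
Proof. by elim: n => //= n ->; rewrite /g; alg. Qed.

Lemma iter_gD n N x y : iter n (g N) (x + y) = iter n (g N) x + iter n (g N) y.
Proof. by elim: n => //= n ->; rewrite /g; alg. Qed.

Lemma F_g N x : 2^-1 *: (g N x + e (step_size N) *c g N x) = x.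
Proof.
have s0 := step_size_gt0 N; rewrite /g; set f := e (step_size N / 2).
transitivity (x + 2^-1 *: ((2 *: e (step_size N) - f - e (step_size N) *c f) *c x)); first by alg.
by rewrite e_halve // cmul0l scaler0 addr0.
Qed.

(** This is F_N^-n h, with each inverse factor applied n times. *)
Fixpoint dpart n N : A := if N is M.+1 then iter n (g M) (dpart n M) else h.

Lemma F_dpart n N : F N (dpart n.+1 N) = dpart n N.
Proof.
elim: N => [|N IHN]; first by rewrite /F /= cmul0l addr0 scale1r.
rewrite FS /= F_g -IHN /F iter_gD iter_gZ iter_g_comm //; exact: bicomm_cpart.
Qed.

(** The operator 1 - e_t commutes with the n N inverse factors, each of norm at most 2, and sends
    [h] to an element of norm at most 2t. *)
Lemma rnorm_dpart n N t : 0 < t ->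
  rnorm (dpart n N - e t *c dpart n N) <= 2 ^+ (n * N) * (2 * t).
Proof.
move=> t0; elim: N => [|N IHN]; first by rewrite muln0 mul1r rnorm_e_h.
rewrite /= iter_g_comm; last exact: bicomm_e.
rewrite -iter_gB; apply: le_trans (rnorm_iter_g _ _ _) _.
by rewrite mulnS exprD -mulrA ler_pM2l ?exprn_gt0.
Qed.

Lemma dpart_increment n N :
  rnorm (dpart n N.+1 - dpart n N) <= 2 ^+ (n + n.+1 ^ 2) / 2 ^+ N.
Proof.
apply: le_trans (rnorm_iter_g_sub _ _ _) _.
apply: le_trans (ler_wpM2l _ (rnorm_dpart n N (half_step_size_gt0 N))) _; first by rewrite exprn_ge0.
rewrite [2 * _]mulrC divfK ?gt_eqF // mulrA -exprD ler_pdivlMr ?exprn_gt0 //.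
rewrite mulrAC /step_size ler_pdivrMr ?exprn_gt0 // -!exprD ler_weXn2l ?ler1n //.
(* The exponents compare because (n+1) N <= (n+1)^2 + N^2. *)
nia.
Qed.

(** With b the limit of c_N and d_n that of F_N^-n h, the relation F_N F_N^-(n+1) h = F_N^-n h
    becomes b d_{n+1} = d_n; as d_0 = h, this gives h = b^(n+1) d_{n+1}. *)
Lemma power_factorization_resolvent :
  exists b, forall n, exists c, h = iter n (cstar_mul b) b *c c.
Proof.
have [b hb] := geometric_increments_converge cpart_increment.
have /choice[d hd] := fun n => geometric_increments_converge (dpart_increment n).
have bd n : b *c d n.+1 = d n.
  apply/eqP; rewrite -subr_eq0; apply/eqP.
  set C := fun n => 2 * 2 ^+ (n + n.+1 ^ 2) : R.
  have C0 m : 0 <= C m by rewrite mulr_ge0 // exprn_ge0.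
  (* The summands of the constant bound, in order, the four terms into which the difference is split
     below. *)
  apply: (@rnorm_eq_lim0 _ _ (4 * rnorm (d n.+1) + (rnorm b + 4) * C n.+1
      + (rnorm (d n.+1) + C n.+1) + C n)) => N.
  have p1 : 1 <= 2 ^+ N :> R by rewrite exprn_ege1 // ler1n.
  have p0 : 0 < 2 ^+ N :> R by rewrite exprn_gt0.
  have div_le (a : R) : 0 <= a -> a / 2 ^+ N <= a by move=> a0; rewrite ler_pdivrMr // ler_peMr.
  pose x := dpart n.+1 N.
  have -> : b *c d n.+1 - d n = (b - cpart N) *c d n.+1 + cpart N *c (d n.+1 - x)
       - (2^-1) ^+ N *: x - (d n - dpart n N) by rewrite -(F_dpart n N) -/x /F; alg.
  have cle : rnorm (cpart N) <= rnorm b + 4.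
    have -> : cpart N = b - (b - cpart N) by lmod.
    apply: le_trans (rnormB _ _) _; rewrite lerD2l; apply: le_trans (hb N) _.
    by rewrite -natrM div_le.
  have xle : rnorm x <= rnorm (d n.+1) + C n.+1.
    have -> : x = d n.+1 - (d n.+1 - x) by lmod.
    apply: le_trans (rnormB _ _) _; rewrite lerD2l; apply: le_trans (hd _ N) _.
    exact: div_le.
  have b1 : rnorm ((b - cpart N) *c d n.+1) <= 4 * rnorm (d n.+1) / 2 ^+ N.
    apply: le_trans (rnormM _ _) _; rewrite mulrAC ler_wpM2r ?rnorm_ge0 //.
    by apply: le_trans (hb N) _; rewrite -natrM.
  have b2 : rnorm (cpart N *c (d n.+1 - x)) <= (rnorm b + 4) * C n.+1 / 2 ^+ N.
    apply: le_trans (rnormM _ _) _; rewrite -mulrA.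
    by apply: ler_pM; rewrite ?rnorm_ge0 //; exact: hd.
  have b3 : rnorm ((2^-1) ^+ N *: x) <= (rnorm (d n.+1) + C n.+1) / 2 ^+ N.
    by rewrite rnorm_halfX ler_pM2r // invr_gt0.
  rewrite !(mulrDl _ _ (2 ^+ N)^-1).
  apply: le_trans (rnormB _ _) (lerD _ (hd n N)).
  apply: le_trans (rnormB _ _) (lerD (le_trans (rnormD _ _) (lerD b1 b2)) _).
  by rewrite -mulrDl.
have d0 : d 0%N = h.
  apply/eqP; rewrite -subr_eq0; apply/eqP.
  apply: (rnorm_eq_lim0 (C := 2 * 2 ^+ (0 + 1 ^ 2))) => N.
  have -> : h = dpart 0 N by elim: N.
  exact: hd.
exists b => n; exists (d n.+1).
have itM (c x : A) m : iter m (cstar_mul b) c *c x = iter m (cstar_mul b) (c *c x).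
  by elim: m => //= m <-; rewrite cstar_mulA.
rewrite itM bd -d0; elim: n => //= n ->.
by rewrite -iterS iterSr bd.
Qed.

End Factorization.

Lemma power_factorization (R : realType) (A : cstarAlgType R) (h : A) :
  cstar_adj h = h ->
  exists b : A, forall n, exists c, h = iter n (cstar_mul b) b *c c.
Proof.
move=> h_sa.
have /choice[e he] (t : R) : exists e, 0 < t -> resolvent h t e.
  case: (ltP 0 t) => [/(resolvent_exists h_sa)[e he]|_]; first by exists e.
  (* A default value for t <= 0, where nothing is asserted. *)
  by exists 0.
exact (power_factorization_resolvent h_sa he).
Qed.

(** * Semiprime ideals *)

Section Subspace.
Variables (K : numFieldType) (V : lmodType K).

Definition is_subspace (S : set V) : Prop :=
  S 0 /\ forall k x y, S x -> S y -> S (k *: x + y).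

Variable S : set V.
Hypothesis subS : is_subspace S.

Lemma subspaceD x y : S x -> S y -> S (x + y).
Proof. by move=> Sx Sy; have := subS.2 1 x y Sx Sy; rewrite scale1r. Qed.

Lemma subspaceZ k x : S x -> S (k *: x).
Proof. by move=> Sx; have := subS.2 k x 0 Sx subS.1; rewrite addr0. Qed.

Lemma subspaceN x : S x -> S (- x).
Proof. by move=> Sx; rewrite -scaleN1r; apply: subspaceZ. Qed.

Lemma subspaceB x y : S x -> S y -> S (x - y).
Proof. by move=> Sx Sy; apply: subspaceD => //; apply: subspaceN. Qed.

Lemma linear_span_sub (G : set V) : G `<=` S -> linear_span G `<=` S.
Proof.
move=> GS _ [n [k [s [Gs ->]]]].
by apply: big_ind => [|x y|i _]; [exact: subS.1|exact: subspaceD|apply/subspaceZ/GS].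
Qed.

End Subspace.

Lemma linear_span_subspace (K : numFieldType) (V : lmodType K) (G : set V) :
  is_subspace (linear_span G).
Proof.
split=> [|c _ _ [n [k [s [Gs ->]]]] [m [l [t [Gt ->]]]]].
  by exists 0%N, (fun=> 0), (fun=> 0); rewrite big_ord0; split=> // -[].
exists (n + m)%N, (fun i : 'I_(n + m) => match fintype.split i with inl j => c * k j | inr j => l j end),
  (fun i : 'I_(n + m) => match fintype.split i with inl j => s j | inr j => t j end); split.
  by move=> i; case: (fintype.split i).
rewrite big_split_ord /= scaler_sumr; congr (_ + _); apply: eq_bigr => i _.
  by rewrite (unsplitK (inl i)) scalerA.
by rewrite (unsplitK (inr i)).
Qed.

Lemma linear_span_incl (K : numFieldType) (V : lmodType K) (G : set V) :
  G `<=` linear_span G.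
Proof.
move=> x Gx; exists 1%N, (fun=> 1), (fun=> x); split=> //.
by rewrite big_ord1 scale1r.
Qed.

Lemma commutator_span_incl (R : realType) (A : cstarAlgType R) (X Y : set A) x y :
  X x -> Y y -> commutator_span X Y (commutator x y).
Proof. by move=> Xx Yy; apply: linear_span_incl; exists x => //; exists y. Qed.

(** * Ideals and their extension by one element *)

Section Ideals.
Variables (R : realType) (A : cstarAlgType R).
Implicit Types (I J Q : set A) (x y a : A).

Lemma ideal_subspace I : is_ideal I -> is_subspace I.
Proof. by case. Qed.

Lemma idealMl I a x : is_ideal I -> I x -> I (a *c x).
Proof. by case=> _ _ h _; apply: h. Qed.

Lemma idealMr I x a : is_ideal I -> I x -> I (x *c a).
Proof. by case=> _ _ _ h; apply: h. Qed.

Lemma ideal_generated_ideal (S : set A) : is_ideal (ideal_generated S).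
Proof.
split=> [I [[] //]|k x y Ix Iy I IS|a x Ix I IS|a x Ix I IS].
- by apply: (ideal_subspace IS.1).2; [apply: Ix|apply: Iy].
- by apply: idealMl; [exact: IS.1|exact: Ix].
- by apply: idealMr; [exact: IS.1|exact: Ix].
Qed.

Lemma ideal_generated_incl (S : set A) : S `<=` ideal_generated S.
Proof. exact: sub_smallest. Qed.

Lemma ideal_generated_sub (S I : set A) : is_ideal I -> S `<=` I -> ideal_generated S `<=` I.
Proof. by move=> iI SI; apply: smallest_sub. Qed.

Definition semiprime Q : Prop := forall x, (forall a, Q (x *c a *c x)) -> Q x.

Definition adjoin J x := ideal_generated (J `|` [set x]).

Lemma adjoin_ideal J x : is_ideal (adjoin J x).
Proof. exact: ideal_generated_ideal. Qed.

Lemma adjoin_incl J x : J `<=` adjoin J x.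
Proof. by move=> y Jy; apply: ideal_generated_incl; left. Qed.

Lemma adjoin_mem J x : adjoin J x x.
Proof. by apply: ideal_generated_incl; right. Qed.

Lemma adjoin_sub J I x : is_ideal I -> J `<=` I -> I x -> adjoin J x `<=` I.
Proof. by move=> iI JI Ix; apply: ideal_generated_sub => // y [/JI //|->]. Qed.

(** First z varies with x on the left, then y varies. Each time the elements that work for all
    middle factors form an ideal containing [J] and [x]. *)
Lemma adjoin_triple J I x : is_ideal I -> J `<=` I -> (forall a, I (x *c a *c x)) ->
  forall y a z, adjoin J x y -> adjoin J x z -> I (y *c a *c z).
Proof.
move=> iI JI Ix.
have right a z : adjoin J x z -> I (x *c a *c z).
  move=> /(@adjoin_sub J [set z | forall a, I (x *c a *c z)] x); apply => //; last first.
    by move=> w Jw b; apply: idealMl => //; apply: JI.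
  split=> [b|k u v hu hv b|b u hu c|b u hu c] /=.
  - by rewrite cmul0r; apply: (ideal_subspace iI).1.
  - by rewrite !cmulE; apply: (ideal_subspace iI).2.
  - by rewrite cstar_mulA -(cstar_mulA x); apply: hu.
  - by rewrite cstar_mulA; apply: idealMr => //; apply: hu.
move=> y a z xy xz; move: y xy a.
suff : adjoin J x `<=` [set y | forall a, I (y *c a *c z)] by [].
apply: adjoin_sub; last 1 first.
- by move=> a; apply: right.
- split=> [b|k u v hu hv b|b u hu c|b u hu c] /=.
  + by rewrite !cmul0l; apply: (ideal_subspace iI).1.
  + by rewrite !cmulE; apply: (ideal_subspace iI).2.
  + by rewrite -!cstar_mulA; apply: idealMl => //; rewrite cstar_mulA; apply: hu.
  + by rewrite -(cstar_mulA u); apply: hu.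
- by move=> w Jw b; rewrite -cstar_mulA; apply: idealMr => //; apply: JI.
Qed.

Lemma not_ideal_self_adjoint J x : is_ideal J -> ~ J x -> exists h, cstar_adj h = h /\ ~ J h.
Proof.
move=> iJ nJx; have sJ := ideal_subspace iJ.
pose ic := imag (1 : R); have icc : ic * ic = -1.
  by apply/eqP; rewrite eq_complex /=; apply/andP; split; apply/eqP; ring.
have s1 : cstar_adj (x + cstar_adj x) = x + cstar_adj x.
  by rewrite cstar_adjD cstar_adjK addrC.
have s2 : cstar_adj (ic *: (x - cstar_adj x)) = ic *: (x - cstar_adj x).
  rewrite /ic cstar_adjZ conj_imag -[- cstar_adj x]scaleN1r cstar_adjD cstar_adjZ cstar_adjK.
  by rewrite rmorphN1; lmod.
have [J1|] := EM (J (x + cstar_adj x)); last by exists (x + cstar_adj x).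
have [J2|] := EM (J (ic *: (x - cstar_adj x))); last by exists (ic *: (x - cstar_adj x)).
case: nJx; have -> : x = 2^-1 *: (x + cstar_adj x) + (- (2^-1 * ic)) *: (ic *: (x - cstar_adj x)).
  rewrite scalerA mulNr -mulrA icc; lmod.
by apply: (subspaceD sJ); apply: (subspaceZ sJ).
Qed.

(* With [h = b^(n+1) c_n] not in [J] for every [n], the witness consists of the
   [x] such that adjoining [x] to an ideal above [J] never captures a power of [b]
   unless the ideal already contains one; it misses [b] itself. *)
Lemma proper_ideal_semiprime J : is_ideal J -> J <> [set: A] ->
  exists Q, [/\ is_ideal Q, semiprime Q, J `<=` Q & Q <> [set: A]].
Proof.
move=> iJ nJ; have [h [h_sa nJh]] : exists h, cstar_adj h = h /\ ~ J h.
  have [x nJx] : exists x, ~ J x.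
    by apply: contrapT => /forallNP/= nx; apply: nJ; apply/seteqP; split=> // x _; exact: contrapT.
  exact: not_ideal_self_adjoint nJx.
have [b hb] := power_factorization h_sa.
(* [pw n] is b^(n+1), so the powers start at b itself. *)
pose pw n := iter n (cstar_mul b) b.
pose captures I := exists n, I (pw n).
pose Q := [set x | forall I, is_ideal I -> J `<=` I -> captures (adjoin I x) -> captures I].
have JQ : J `<=` Q.
  move=> x Jx I iI JI [n Ib]; exists n.
  by move: Ib; apply: adjoin_sub => //; apply: JI.
have mono I x y : adjoin I x y -> captures (adjoin I y) -> captures (adjoin I x).
  move=> xy [n yn]; exists n; move: yn.
  by apply: adjoin_sub => //; [exact: adjoin_ideal|exact: adjoin_incl].
(* If adjoining z captures a power, so does adjoining x and then y; membership in [Q] discards first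
   y, then x. *)
have trans x y z : (forall I, J `<=` I -> adjoin (adjoin I x) y z) -> Q x -> Q y -> Q z.
  move=> xyz Qx Qy I iI JI [n zn]; apply: Qx => //; apply: Qy.
  - exact: adjoin_ideal.
  - exact: subset_trans JI (@adjoin_incl _ _).
  - exists n; move: zn; apply: adjoin_sub; first exact: adjoin_ideal.
      by move=> w Iw; do 2 apply: adjoin_incl.
    exact: xyz.
have iQ : is_ideal Q.
  split.
  - by apply: JQ; apply: (ideal_subspace iJ).1.
  - move=> k x y Qx Qy; apply: (trans x y) => // I JI.
    have := adjoin_ideal (adjoin I x) y => iI.
    apply: (ideal_subspace iI).2; last exact: adjoin_mem.
    by apply: adjoin_incl; apply: adjoin_mem.
  - move=> a x Qx I iI JI ca; apply: Qx => //; apply: mono ca.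
    by apply: (@idealMl (adjoin I x)); [exact: adjoin_ideal|exact: adjoin_mem].
  - move=> a x Qx I iI JI ca; apply: Qx => //; apply: mono ca.
    by apply: (@idealMr (adjoin I x)); [exact: adjoin_ideal|exact: adjoin_mem].
have pwM n y : pw n *c y = iter n.+1 (cstar_mul b) y.
  by rewrite /pw iterSr; elim: n => //= n <-; rewrite cstar_mulA.
have pw_pw n m : pw n *c b *c pw m = pw (n.+1 + m.+1)%N.
  by rewrite -cstar_mulA pwM /pw iterD.
exists Q; split=> //.
- move=> x Qx I iI JI [n xn].
  (* [I'] is I + Q and contains x A x. So b^(n+1) in the extension by x puts b^(2n+3) in I + Q, and
     its [Q]-component q can then be discarded. *)
  pose I' := [set z | exists2 q, Q q & I (z - q)].
  have sI := ideal_subspace iI; have sQ := ideal_subspace iQ.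
  have iI' : is_ideal I'.
    split.
    + by exists 0; [exact: sQ.1|rewrite subr0; exact: sI.1].
    + move=> k y z [q Qq Iq] [r Qr Ir]; exists (k *: q + r); first exact: sQ.2.
      have -> : k *: y + z - (k *: q + r) = k *: (y - q) + (z - r) by lmod.
      exact: sI.2.
    + move=> a y [q Qq Iq]; exists (a *c q); first exact: (@idealMl Q).
      have -> : a *c y - a *c q = a *c (y - q) by alg.
      by apply: (@idealMl I).
    + move=> a y [q Qq Iq]; exists (q *c a); first exact: (@idealMr Q).
      have -> : y *c a - q *c a = (y - q) *c a by alg.
      by apply: (@idealMr I).
  have [||q Qq Iq] := @adjoin_triple I I' x iI' _ _ _ b _ xn xn.
  + by move=> y Iy; exists 0; [exact: sQ.1|rewrite subr0].
  + by move=> a; exists (x *c a *c x) => //; rewrite subrr; exact: sI.1.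
  rewrite pw_pw in Iq; apply: (Qq I) => //; exists (n.+1 + n.+1)%N.
  rewrite -[pw _](subrK q); apply: (subspaceD (ideal_subspace (adjoin_ideal I q))).
    exact: adjoin_incl.
  exact: adjoin_mem.
- move=> QT; have : Q b by rewrite QT.
  move=> /(_ J iJ (@subset_refl _ J))[|n Jn].
    by exists 0%N; apply: adjoin_mem.
  by have [c hc] := hb n; apply: nJh; rewrite hc; apply: (@idealMr J).
Qed.

End Ideals.

(** * Lie ideals *)

Section Lie.
Variables (R : realType) (A : cstarAlgType R).
Implicit Types (Q : set A) (x y z a r u : A).

Let L : set A := commutator_span [set: A] [set: A].
Let K : set A := commutator_span L L.

Let subL : is_subspace L. Proof. exact: linear_span_subspace. Qed.
Let subK : is_subspace K. Proof. exact: linear_span_subspace. Qed.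

Lemma commutator_derived x y : L (commutator x y).
Proof. exact: commutator_span_incl. Qed.

Lemma second_derived_incl x y : L x -> L y -> K (commutator x y).
Proof. exact: commutator_span_incl. Qed.

(** By the Jacobi identity, [[x,y],r] = [[x,r],y] + [x,[y,r]], and commutators with [r] lie in
    [L]. *)
Lemma second_derived_Lie_ideal a r : K a -> K (commutator a r).
Proof.
move: a; suff : K `<=` [set a | K (commutator a r)] by [].
apply: linear_span_sub.
  split=> [|k x y Kx Ky] /=.
    by have -> : commutator 0 r = 0; [alg|exact: subK.1].
  have -> : commutator (k *: x + y) r = k *: commutator x r + commutator y r by alg.
  exact: subK.2.
move=> _ [x Lx [y Ly <-]] /=.
have -> : commutator (commutator x y) r =
    commutator (commutator x r) y + commutator x (commutator y r) by alg.
by apply: (subspaceD subK); apply: second_derived_incl => //; exact: commutator_derived.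
Qed.

Section Semiprime.
Variable Q : set A.
Hypotheses (iQ : is_ideal Q) (spQ : semiprime Q).

Let sQ : is_subspace Q := ideal_subspace iQ.

(* If [d = ad a] satisfies [d^2 = 0] modulo [Q], then [2 d(r) d(s) = d^2(r s)]
   forces [d(r) A d(r)] into [Q]. *)
Lemma ad_square_zero a :
  (forall r, Q (commutator a (commutator a r))) -> forall r, Q (commutator a r).
Proof.
move=> d2; have dd r s : Q (commutator a r *c commutator a s).
  have -> : commutator a r *c commutator a s =
      2^-1 *: (commutator a (commutator a (r *c s)) - commutator a (commutator a r) *c s
        - r *c commutator a (commutator a s)) by alg.
  apply: (subspaceZ sQ); do 2 ?[apply: (subspaceB sQ)] => //.
    exact: (idealMr _ iQ).
  exact: (idealMl _ iQ).
move=> r; apply: spQ => s.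
(* The Leibniz rule d(s r) = d(s) r + s d(r) moves the middle factor under d. *)
have -> : commutator a r *c s *c commutator a r =
    commutator a r *c commutator a (s *c r) - commutator a r *c commutator a s *c r by alg.
by apply: (subspaceB sQ) => //; exact: (idealMr _ iQ).
Qed.

Lemma semiprime_commutative :
  (forall x y, K x -> K y -> Q (commutator x y)) -> forall x y, Q (commutator x y).
Proof.
move=> hK.
have centK a : K a -> forall r, Q (commutator a r).
  by move=> Ka; apply: ad_square_zero => r; apply: hK => //; exact: second_derived_Lie_ideal.
have centL u : L u -> forall r, Q (commutator u r).
  move=> Lu; apply: ad_square_zero => r; set z := commutator u (commutator u r).
  have Kd2 s : K (commutator u (commutator u s)).
    by apply: second_derived_incl => //; exact: commutator_derived.
  have Kz : K z by exact: Kd2.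
  have zz : Q (z *c z).
    (* Since [u,[u,u r]] = u z lies in [K], it is central modulo [Q]. Expanding [u z,[u,r]] isolates
       z^2, and centrality of z then puts z A z in [Q]. *)
    have -> : z *c z = commutator (commutator u (commutator u (u *c r))) (commutator u r)
        - u *c commutator z (commutator u r) by rewrite /z; alg.
    apply: (subspaceB sQ); first exact: centK.
    by apply: (idealMl _ iQ); exact: centK.
  apply: spQ => a.
  have -> : z *c a *c z = z *c z *c a - z *c commutator z a by alg.
  apply: (subspaceB sQ); first exact: (idealMr _ iQ).
  by apply: (idealMl _ iQ); exact: centK.
move=> x; apply: ad_square_zero => r.
have -> : commutator x (commutator x r) = - commutator (commutator x r) x by alg.
by apply: (subspaceN sQ); apply: centL; exact: commutator_derived.
Qed.

End Semiprime.

(** The set [T] on the right is a subalgebra containing [K]. The members of [T] whose right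
    multiples stay in [T] form an ideal, and this ideal contains [K,K]. *)
Lemma ideal_of_commutators_normalizes :
  ideal_generated (commutator_span K K) `<=` [set x | forall a, K (commutator x a)].
Proof.
pose T := [set x | forall a, K (commutator x a)].
have sT : is_subspace T.
  split=> [a|k x y Tx Ty a].
    by have -> : commutator 0 a = 0; [alg|exact: subK.1].
  have -> : commutator (k *: x + y) a = k *: commutator x a + commutator y a by alg.
  exact: subK.2.
have KT : K `<=` T by move=> x Kx a; exact: second_derived_Lie_ideal.
have mulT x y : T x -> T y -> T (x *c y).
  move=> Tx Ty a.
  have -> : commutator (x *c y) a = commutator x (y *c a) + commutator y (a *c x) by alg.
  exact: (subspaceD subK).
pose T2 := [set x | T x /\ forall a, T (x *c a)].
suff sub : ideal_generated (commutator_span K K) `<=` T2 by move=> x /sub[].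
have iT2 : is_ideal T2.
  split=> [|k x y [Tx Txa] [Ty Tya]|c x [Tx Txa]|c x [Tx Txa]].
  - by split=> [|a]; rewrite ?cmul0l; exact: sT.1.
  - by split=> [|a]; rewrite ?cmulE; exact: sT.2.
  (* Left multiples reduce to right ones, as the two differ by a commutator in [K]. *)
  - have swap y : T y -> T (y *c c) -> T (c *c y).
      move=> Ty Tyc; have -> : c *c y = y *c c - commutator y c by alg.
      by apply: (subspaceB sT) => //; apply: KT; exact: Ty.
    split=> [|a]; first exact: swap.
    by rewrite -cstar_mulA; apply: swap; rewrite -?cstar_mulA.
  - by split=> [|a]; rewrite -?cstar_mulA.
apply: ideal_generated_sub => //; apply: (linear_span_sub (ideal_subspace iT2)).
move=> _ [x Kx [y Ky <-]]; split=> [|a].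
  by apply: KT; exact: second_derived_Lie_ideal.
(* The first term lies in [K] and the second is a product of two elements of [K], so both lie in
   [T]. *)
have -> : commutator x y *c a = commutator x (y *c a) - y *c commutator x a by alg.
apply: (subspaceB sT); first by apply: KT; exact: second_derived_Lie_ideal.
by apply: mulT; apply: KT => //; exact: second_derived_Lie_ideal.
Qed.

End Lie.

Unset Implicit Arguments.

Theorem corollary3p4 (R : realType) (A : cstarAlgType R)
    (hA : ideal_generated (commutator_span [set: A] [set: A]) = [set: A]) :
  commutator_span (commutator_span [set: A] [set: A])
                  (commutator_span [set: A] [set: A])
  = commutator_span [set: A] [set: A].
Proof.
set L := commutator_span [set: A] [set: A]; set K := commutator_span L L.
have sL : is_subspace L by exact: linear_span_subspace.
have sK : is_subspace K by exact: linear_span_subspace.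
apply/seteqP; split.
  by apply: (linear_span_sub sL) => _ [x _ [y _ <-]]; exact: commutator_span_incl.
apply: (linear_span_sub sK) => _ [x _ [y _ <-]].
pose J := ideal_generated (commutator_span K K).
suff J1 : J x by exact: ideal_of_commutators_normalizes J1 y.
have [-> //|/(proper_ideal_semiprime (ideal_generated_ideal _))] := EM (J = [set: A]).
(* If [J] were proper, [Q] would contain [K,K], hence every commutator, hence by [hA] all of [A]. *)
move=> [Q [iQ spQ JQ nQ]]; case: nQ.
apply/seteqP; split=> // z _; have : [set: A] z by [].
rewrite -hA; apply: (ideal_generated_sub iQ).
apply: (linear_span_sub (ideal_subspace iQ)) => _ [u _ [v _ <-]].
apply: semiprime_commutative => // {}u {}v Ku Kv.
by apply: JQ; apply: ideal_generated_incl; apply: (@commutator_span_incl R A K K).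
Qed.
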